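(* Let $(\widetilde{p}^{(1)},\mathbf{v}^{(1)})$ and $(\widetilde{p}^{(2)},\mathbf{v}^{(2)})$ be solutions of $$\widetilde{\mu}_0(\mathbf{x})\, g(\widetilde{p}(\mathbf{x}))\,\mathbf{K}^{-1}(\mathbf{x})\,\mathbf{v}(\mathbf{x}) + \mathrm{grad}[\widetilde{p}(\mathbf{x})] = \mathbf{0} \ \text{in } \Omega,\qquad \mathrm{div}[\mathbf{v}(\mathbf{x})]=0 \ \text{in } \Omega,$$ corresponding to the prescribed boundary conditions $(\widetilde{p}_{\mathrm{p}}^{(1)},v_n^{(1)})$ and $(\widetilde{p}_{\mathrm{p}}^{(2)},v_n^{(2)})$ respectively, i.e. for $i=1,2$, $\widetilde{p}^{(i)}=\widetilde{p}^{(i)}_{\mathrm{p}}$ on $\Gamma^{p}$ and $\mathbf{v}^{(i)}\cdot\widehat{\mathbf{n}}=v_n^{(i)}$ on $\Gamma^{v}$. Then $$\int_{\Gamma^{v}} v_{n}^{(2)}\exp\!\left[-\beta\left(\frac{\widetilde{p}^{(1)}}{p_0}-1\right)\right]\mathrm{d}\Gamma-\int_{\Gamma^{p}}\exp\!\left[-\beta\left(\frac{\widetilde{p}_{\mathrm{p}}^{(2)}}{p_0}-1\right)\right]\mathbf{v}^{(1)}\cdot\widehat{\mathbf{n}}\,\mathrm{d}\Gamma$$ $$=\int_{\Gamma^{v}} v_{n}^{(1)}\exp\!\left[-\beta\left(\frac{\widetilde{p}^{(2)}}{p_0}-1\right)\right]\mathrm{d}\Gamma-\int_{\Gamma^{p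}}\exp\!\left[-\beta\left(\frac{\widetilde{p}_{\mathrm{p}}^{(1)}}{p_0}-1\right)\right]\mathbf{v}^{(2)}\cdot\widehat{\mathbf{n}}\,\mathrm{d}\Gamma.$$
   Context: $\Omega\subset\mathbb{R}^{nd}$ is a bounded Lipschitz domain with boundary $\partial\Omega=\overline{\Omega}\setminus\Omega$ and unit outward normal $\widehat{\mathbf{n}}$. The boundary is partitioned as $\Gamma^{p}\cup\Gamma^{v}=\partial\Omega$, $\Gamma^{p}\cap\Gamma^{v}=\emptyset$; both solutions use the same partition. The permeability $\mathbf{K}(\mathbf{x})$ is a symmetric tensor field for which there are constants $0<k_1\le k_2$ with $k_1\,\boldsymbol{\zeta}\cdot\boldsymbol{\zeta}\le \boldsymbol{\zeta}\cdot\mathbf{K}(\mathbf{x})\boldsymbol{\zeta}\le k_2\,\boldsymbol{\zeta}\cdot\boldsymbol{\zeta}$ for all $\mathbf{x}\in\Omega$ and all $\boldsymbol{\zeta}\in\mathbb{R}^{nd}\setminus\{\mathbf 0\}$. Constants: $\mu_0>0$ (reference viscosity), $p_0>0$ (reference pressure), $\beta\ge 0$. The body force is conservative, $\rho\mathbf{b}=-\mathrm{grad}[\xi]$ for a given scalar field $\xi$ (the same for both solutions), and $\widetilde{p}=p+\xi$ is the modified pressure ($p$ being the pressure). Define $$\widetilde{\mu}_0(\mathbf{x})=\mu_0\exp\!\left[-\frac{\beta\,\xi(\mathbf{x})}{p_0}\right]>0,\qquad g(s)=\exp\!\left[\beta\left(\frac{s}{p_0}-1\right)\right].$$ The solution fields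 $\widetilde{p}^{(i)},\mathbf{v}^{(i)}$ are assumed regular enough that the equations hold pointwise, the boundary values and all integrals are well defined, and the divergence theorem is applicable. *)

(* Defs.v *)
From HB Require Import structures.
From mathcomp Require Import all_boot all_order all_algebra.
From mathcomp Require Import all_classical all_reals all_analysis.

Set Implicit Arguments.
Unset Strict Implicit.
Unset Printing Implicit Defensive.

Import Order.TTheory GRing.Theory Num.Theory.
Import numFieldNormedType.Exports.

Local Open Scope classical_set_scope.
Local Open Scope ring_scope.

(* [`|x|] is the sup norm on ['cV[R]_n]; lengths and diameters below are
   Euclidean. *)
Definition dot (R : realType) (n : nat) (u w : 'cV[R]_n) : R :=
  \sum_(i < n) u i 0 * w i 0.

Definition enorm (R : realType) (n : nat) (u : 'cV[R]_n) : R :=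
  Num.sqrt (dot u u).

Definition grad (R : realType) (n : nat) (f : 'cV[R]_n -> R) (x : 'cV[R]_n) :
  'cV[R]_n := \col_(i < n) 'D_(delta_mx i 0) f x.

Definition div (R : realType) (n : nat) (w : 'cV[R]_n -> 'cV[R]_n)
  (x : 'cV[R]_n) : R :=
  \sum_(i < n) 'D_(delta_mx i 0) (fun y => w y i 0) x.

(* Infimum of the total weight of countable covers of [X]; empty pieces are
   free whatever [tau] says. *)
Section cover_outer.
Context (R : realType) (T : pointedType).
Implicit Types (tau : set T -> \bar R) (X : set T).
Local Open Scope ereal_scope.

Definition cover_weight tau X : \bar R := if X == set0 then 0 else tau X.

Definition cover_outer tau X : \bar R :=
  ereal_inf [set \sum_(k <oo) cover_weight tau (A k) |
              A in [set A : (set T)^nat | X `<=` \bigcup_k A k]].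

(* [mu_ext] for the semiring of all subsets supplies the proofs. *)
Definition all_subsets : Type := T.
HB.instance Definition _ := Pointed.on all_subsets.
HB.instance Definition _ := @isMeasurable.Build default_measure_display
  all_subsets setT I (fun _ _ => I) (fun _ _ => I).

Lemma cover_outerE tau X :
  cover_outer tau X = @mu_ext _ all_subsets R (cover_weight tau) X.
Proof.
by congr (ereal_inf _); apply/seteqP; split => y [A];
  [move=> XA; exists A|case=> _ XA; exists A].
Qed.

Lemma cover_weight0 tau : cover_weight tau set0 = 0.
Proof. by rewrite /cover_weight eqxx. Qed.

Lemma cover_weight_ge0 tau : (forall X, 0 <= tau X) ->
  forall X, 0 <= cover_weight tau X.
Proof. by move=> t0 X; rewrite /cover_weight; case: ifP. Qed.

Section theory.
Variable tau : set T -> \bar R.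
Hypothesis tau_ge0 : forall X, 0 <= tau X.

Lemma cover_outer0 : cover_outer tau set0 = 0.
Proof.
by rewrite cover_outerE mu_ext0//;
  [exact: cover_weight0|exact: cover_weight_ge0].
Qed.

Lemma cover_outer_ge0 X : 0 <= cover_outer tau X.
Proof. by rewrite cover_outerE mu_ext_ge0//; exact: cover_weight_ge0. Qed.

Lemma le_cover_outer : {homo cover_outer tau : A B / A `<=` B >-> A <= B}.
Proof. by move=> A B AB; rewrite !cover_outerE; exact: le_mu_ext. Qed.

Lemma cover_outer_sigma_subadditive : sigma_subadditive (cover_outer tau).
Proof.
move=> F; rewrite cover_outerE.
under eq_eseriesr do rewrite cover_outerE.
by apply: mu_ext_sigma_subadditive; exact: cover_weight_ge0.
Qed.

End theory.
End cover_outer.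

(* n-dimensional Lebesgue measure, by covers with axis-parallel boxes. *)
Section lebesgue_space.
Context (R : realType) (n : nat).
Local Open Scope ereal_scope.

Definition box (a b : 'cV[R]_n) : set 'cV[R]_n :=
  [set x | forall i, (a i 0 <= x i 0 <= b i 0)%R].

Definition box_weight (X : set 'cV[R]_n) : \bar R :=
  ereal_inf [set (\prod_(i < n) (ab.2 i 0 - ab.1 i 0))%R%:E |
    ab in [set ab : 'cV[R]_n * 'cV[R]_n |
            (forall i, (ab.1 i 0 <= ab.2 i 0)%R) /\ X `<=` box ab.1 ab.2]].

Definition lebesgue_outer : set 'cV[R]_n -> \bar R := cover_outer box_weight.

Lemma box_weight_ge0 X : 0 <= box_weight X.
Proof.
apply: le_ereal_inf_tmp => _ [[a b] [/= ab _] <-].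
by rewrite lee_fin; apply: prodr_ge0 => i _; rewrite subr_ge0.
Qed.

HB.instance Definition _ := isOuterMeasure.Build R 'cV[R]_n lebesgue_outer
  (cover_outer0 box_weight_ge0) (cover_outer_ge0 box_weight_ge0)
  (@le_cover_outer _ _ box_weight)
  (cover_outer_sigma_subadditive box_weight_ge0).

Definition lebesgue_outer_measure :
  {outer_measure set 'cV[R]_n -> \bar R} := lebesgue_outer.

Definition volume_measure :
    {measure set (caratheodory_type lebesgue_outer_measure) -> \bar R} :=
  lebesgue_outer_measure.

End lebesgue_space.

(* Volume of the unit ball of R^m: V_0 = 1, V_1 = 2, V_m = (2 pi / m) V_(m-2). *)
Fixpoint ball_volume (R : realType) (m : nat) : R :=
  match m with
  | 0 => 1
  | 1 => 2
  | k.+2 => 2 * pi / k.+2%:R * ball_volume R k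
  end.

Lemma ball_volume_ge0 (R : realType) (m : nat) : 0 <= ball_volume R m.
Proof.
suff : (0 <= ball_volume R m) && (0 <= ball_volume R m.+1) by case/andP.
elim: m => [|m /andP[h1 h2]]; first by rewrite /= ler01 ler0n.
apply/andP; split=> //=.
by rewrite !mulr_ge0// ?invr_ge0// ?ler0n// pi_ge0.
Qed.

(* m-dimensional Hausdorff measure in R^n, normalised so that it agrees with
   m-dimensional area on m-dimensional planes. *)
Section hausdorff.
Context (R : realType) (n : nat) (m : nat).
Local Open Scope ereal_scope.

Definition diam (X : set 'cV[R]_n) : \bar R :=
  ereal_sup [set (enorm (xy.1 - xy.2))%:E | xy in X `*` X].

Definition hausdorff_weight (delta : R) (X : set 'cV[R]_n) : \bar R :=
  if diam X <= delta%:E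
  then (ball_volume R m * (fine (diam X) / 2) ^+ m)%R%:E
  else +oo.

Definition hausdorff_outer (X : set 'cV[R]_n) : \bar R :=
  ereal_sup [set cover_outer (hausdorff_weight delta) X |
              delta in [set delta : R | (0 < delta)%R]].

Lemma fine_diam_ge0 X : (0 <= fine (diam X))%R.
Proof.
have [->|/set0P[x Xx]] := eqVneq X set0.
  by rewrite /diam setX0 image_set0 ereal_sup0.
apply: fine_ge0; apply: le_trans (_ : (enorm (x - x))%:E <= _).
  by rewrite lee_fin sqrtr_ge0.
by apply: ereal_sup_ubound; exists (x, x).
Qed.

Lemma hausdorff_weight_ge0 delta X : 0 <= hausdorff_weight delta X.
Proof.
rewrite /hausdorff_weight; case: ifP => // _.
rewrite lee_fin mulr_ge0 ?ball_volume_ge0// exprn_ge0// divr_ge0//.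
exact: fine_diam_ge0.
Qed.

Lemma hausdorff_outer0 : hausdorff_outer set0 = 0.
Proof.
rewrite /hausdorff_outer.
rewrite (_ : [set _ | _ in _] = [set 0]) ?ereal_sup1//.
apply/seteqP; split => [_ [d _ <-]|_ ->] /=.
  by rewrite cover_outer0//; exact: hausdorff_weight_ge0.
exists 1%R; first exact: ltr01.
by rewrite cover_outer0//; exact: hausdorff_weight_ge0.
Qed.

Lemma le_cover_hausdorff (delta : R) X : (0 < delta)%R ->
  cover_outer (hausdorff_weight delta) X <= hausdorff_outer X.
Proof. by move=> d0; apply: ereal_sup_ubound; exists delta. Qed.

Lemma hausdorff_outer_ge0 X : 0 <= hausdorff_outer X.
Proof.
apply: le_trans (le_cover_hausdorff X ltr01).
by apply: cover_outer_ge0; exact: hausdorff_weight_ge0.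
Qed.

Lemma le_hausdorff_outer : {homo hausdorff_outer : A B / A `<=` B >-> A <= B}.
Proof.
move=> A B AB; apply: ge_ereal_sup => _ [d d0 <-].
exact: le_trans (le_cover_outer _ AB) (le_cover_hausdorff _ d0).
Qed.

Lemma hausdorff_outer_sigma_subadditive : sigma_subadditive hausdorff_outer.
Proof.
move=> F; apply: ge_ereal_sup => _ [d d0 <-].
apply: (le_trans (cover_outer_sigma_subadditive (hausdorff_weight_ge0 d) F)).
apply: lee_nneseries => k *; last exact: le_cover_hausdorff.
by apply: cover_outer_ge0; exact: hausdorff_weight_ge0.
Qed.

HB.instance Definition _ := isOuterMeasure.Build R 'cV[R]_n hausdorff_outer
  hausdorff_outer0 hausdorff_outer_ge0 le_hausdorff_outer
  hausdorff_outer_sigma_subadditive.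

Definition hausdorff_outer_measure :
  {outer_measure set 'cV[R]_n -> \bar R} := hausdorff_outer.

Definition hausdorff_measure :
    {measure set (caratheodory_type hausdorff_outer_measure) -> \bar R} :=
  hausdorff_outer_measure.

End hausdorff.

Definition surface_measure (R : realType) (n : nat) :=
  @hausdorff_measure R n n.-1.

Definition boundary (R : realType) (n : nat) (Om : set 'cV[R]_n) :
  set 'cV[R]_n := closure Om `\` Om.

(* Around each boundary point, Om is the strict epigraph, in some unit
   direction [e], of a Lipschitz function of the coordinates orthogonal to
   [e]; [phi] is only evaluated on the hyperplane orthogonal to [e]. *)
Definition bounded_lipschitz_domain (R : realType) (n : nat)
    (Om : set 'cV[R]_n) : Prop :=
  [/\ Om !=set0, open Om, connected Om, bounded_set Om &
    forall x, boundary Om x ->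
      exists (e : 'cV[R]_n) (phi : 'cV[R]_n -> R) (r : R),
        [/\ dot e e = 1, lipschitz phi, 0 < r &
          forall z, enorm (z - x) < r ->
            (Om z <-> phi (z - dot z e *: e) < dot z e)]].

(* [nu] is the outward unit normal at [x] when, close to [x], Om differs from
   the half-space {z | (z - x).nu < 0} only inside arbitrarily thin cones
   around the hyperplane orthogonal to [nu].  For a Lipschitz graph this is
   differentiability of the graph at [x], so [nu] exists almost everywhere. *)
Definition outward_unit_normal (R : realType) (n : nat) (Om : set 'cV[R]_n)
    (x nu : 'cV[R]_n) : Prop :=
  dot nu nu = 1 /\
  forall eps : R, 0 < eps ->
    exists2 r : R, 0 < r &
      forall z, enorm (z - x) < r ->
        (dot (z - x) nu < - (eps * enorm (z - x)) -> Om z) /\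
        (eps * enorm (z - x) < dot (z - x) nu -> ~ Om z).

Definition normal_field (R : realType) (n : nat) (Om : set 'cV[R]_n)
    (nrm : 'cV[R]_n -> 'cV[R]_n) : Prop :=
  {ae surface_measure R n, forall x,
    boundary Om x -> outward_unit_normal Om x (nrm x)}.

Definition divergence_theorem_applicable (R : realType) (n : nat)
    (Om : set 'cV[R]_n) (nrm w : 'cV[R]_n -> 'cV[R]_n) : Prop :=
  [/\ (volume_measure R n).-integrable Om (fun x => (div w x)%:E),
      (surface_measure R n).-integrable (boundary Om)
        (fun x => (dot (w x) (nrm x))%:E) &
      \int[volume_measure R n]_(x in Om) div w x =
      \int[surface_measure R n]_(x in boundary Om) dot (w x) (nrm x)].

Definition permeability (R : realType) (n : nat) (Om : set 'cV[R]_n)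
    (K : 'cV[R]_n -> 'M[R]_n) : Prop :=
  (forall x, Om x -> (K x)^T = K x) /\
  exists k1 k2 : R, [/\ 0 < k1, k1 <= k2 &
    forall x zeta, Om x -> zeta != 0 ->
      k1 * dot zeta zeta <= dot zeta (K x *m zeta) <= k2 * dot zeta zeta].

Definition mu_tilde (R : realType) (n : nat) (mu0 p0 beta : R)
    (xi : 'cV[R]_n -> R) (x : 'cV[R]_n) : R :=
  mu0 * expR (- (beta * xi x / p0)).

Definition barus (R : realType) (p0 beta s : R) : R :=
  expR (beta * (s / p0 - 1)).

(* [p] is the modified pressure.  The values of [p] and [v] on the boundary
   are their boundary values, i.e. limits from inside Om; since the normal is
   only defined almost everywhere on the boundary, so are these conditions. *)
Record modified_barus_solution (R : realType) (n : nat)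
    (Om Gp Gv : set 'cV[R]_n) (nrm : 'cV[R]_n -> 'cV[R]_n)
    (K : 'cV[R]_n -> 'M[R]_n) (mu0 p0 beta : R) (xi : 'cV[R]_n -> R)
    (pp vn : 'cV[R]_n -> R)
    (p : 'cV[R]_n -> R) (v : 'cV[R]_n -> 'cV[R]_n) : Prop :=
  ModifiedBarusSolution {
    sol_diff_p : forall x, Om x -> differentiable p x ;
    sol_diff_v : forall x, Om x -> differentiable v x ;
    sol_momentum : forall x, Om x ->
      (mu_tilde mu0 p0 beta xi x * barus p0 beta (p x)) *:
        (invmx (K x) *m v x) + grad p x = 0 ;
    sol_mass : forall x, Om x -> div v x = 0 ;
    sol_trace_p : {ae surface_measure R n, forall x, boundary Om x ->
      p y @[y --> within Om (nbhs (x : 'cV[R]_n))] --> p x} ;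
    sol_trace_v : {ae surface_measure R n, forall x, boundary Om x ->
      dot (v y) (nrm x) @[y --> within Om (nbhs (x : 'cV[R]_n))]
        --> dot (v x) (nrm x)} ;
    sol_pressure_bc : {ae surface_measure R n, forall x, Gp x -> p x = pp x} ;
    sol_velocity_bc : {ae surface_measure R n, forall x,
      Gv x -> dot (v x) (nrm x) = vn x} }.

(* Main.v *)
(* The drag coefficient of one solution is cancelled by weighting the velocity
   of the other with the reciprocal exponential: since div v1 = 0 and
   exp(-beta(p2/p0 - 1)) g(p2) = 1, the divergence of exp(-beta(p2/p0 - 1)) v1
   equals (beta/p0) mu_tilde (K^-1 v2).v1, which is symmetric in the two
   solutions because K is.  Integrating over Om and splitting the boundary
   fluxes over Gp and Gv gives the identity. *)
Require Import Defs.
From HB Require Import structures.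
From mathcomp Require Import all_boot all_order all_algebra.
From mathcomp Require Import all_classical all_reals all_analysis.
From mathcomp Require Import ring.

Set Implicit Arguments.
Unset Strict Implicit.
Unset Printing Implicit Defensive.

Import Order.TTheory GRing.Theory Num.Theory.
Import numFieldNormedType.Exports.

Local Open Scope classical_set_scope.
Local Open Scope ring_scope.

(** The boundary conditions hold only almost everywhere, so boundary integrands cannot be exchanged
    pointwise. Integrability supplies the measurability that [ae_eq_integral] asks for. *)
Lemma ae_eq_Rintegral (d : measure_display) (T : measurableType d)
    (R : realType) (mu : {measure set T -> \bar R}) (D : set T) (f g : T -> R) :
  measurable D ->
  mu.-integrable D (EFin \o f) -> mu.-integrable D (EFin \o g) ->
  {ae mu, forall x, D x -> f x = g x} ->
  \int[mu]_(x in D) f x = \int[mu]_(x in D) g x.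
Proof.
move=> mD fi gi fg; rewrite /Rintegral; congr fine.
apply: ae_eq_integral => //.
- exact: measurable_int fi.
- exact: measurable_int gi.
- by apply: filterS fg => x fgx Dx /=; rewrite fgx.
Qed.

Section dot.
Context (R : realType) (n : nat).
Implicit Types (a : R) (u w : 'cV[R]_n) (A : 'M[R]_n).

Lemma dotE u w : dot u w = (u^T *m w) 0 0.
Proof. by rewrite mxE; apply: eq_bigr => i _; rewrite mxE. Qed.

Lemma dotC u w : dot u w = dot w u.
Proof. by apply: eq_bigr => i _; rewrite mulrC. Qed.

Lemma dotZl a u w : dot (a *: u) w = a * dot u w.
Proof. by rewrite /dot mulr_sumr; apply: eq_bigr => i _; rewrite mxE mulrA. Qed.

Lemma dotNl u w : dot (- u) w = - dot u w.
Proof. by rewrite -scaleN1r dotZl mulN1r. Qed.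

Lemma dot_mulmx_sym A u w : A^T = A -> dot (A *m u) w = dot (A *m w) u.
Proof. by move=> AT; rewrite dotE trmx_mul AT -mulmxA -dotE dotC. Qed.

End dot.

Section calculus.
Context (R : realType).

(** The differential of the composite is the composite of the differentials, and the differential of
    [g] at [f x] is multiplication by the derivative of [g] there. *)
Lemma derive_comp (V : normedModType R) (f : V -> R) (g : R -> R) (x v : V) :
  differentiable f x -> derivable g (f x) 1 ->
  'D_v (g \o f) x = 'D_1 g (f x) * 'D_v f x.
Proof.
move=> df /derivable1_diffP dg.
rewrite deriveE; last exact: differentiable_comp.
rewrite [in RHS](deriveE v df).
by rewrite diff_comp//= diff1E//= derive1E mulrC.
Qed.

Context (n : nat).
Implicit Types (f : 'cV[R]_n -> R) (w : 'cV[R]_n -> 'cV[R]_n) (x : 'cV[R]_n).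

Lemma differentiable_entry w x i :
  differentiable w x -> differentiable (fun y => w y i 0) x.
Proof.
move=> dw.
apply: (@differentiable_comp _ _ _ _ w (fun N : 'cV[R]_n => N i 0)) => //.
exact: differentiable_coord.
Qed.

(** Product rule in each coordinate; the terms that differentiate [f] add up to the dot product. *)
Lemma divZ f w x : differentiable f x -> differentiable w x ->
  div (fun y => f y *: w y) x = f x * div w x + dot (grad f x) (w x).
Proof.
move=> df dw; rewrite /div /dot mulr_sumr -big_split/=.
apply: eq_bigr => i _; rewrite [in RHS]mxE.
rewrite (_ : (fun y => _) = f * (fun y => w y i 0)).
  rewrite deriveM; first by rewrite /GRing.scale/= [w x i 0 * _]mulrC.
    exact: diff_derivable.
  by apply: diff_derivable; exact: differentiable_entry.
by apply/funext => y; rewrite mxE.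
Qed.

End calculus.

Section barus.
Context (R : realType) (n : nat) (p0 beta : R).
Implicit Types (p : 'cV[R]_n -> R) (x : 'cV[R]_n).

(** Reciprocal of [barus], kept convertible with the exponential weights written out in the
    theorem. *)
Definition fluidity (s : R) : R := expR (- (beta * (s / p0 - 1))).

Lemma fluidityM_barus s : fluidity s * barus p0 beta s = 1.
Proof. by rewrite -expRD addNr expR0. Qed.

Lemma is_derive_fluidity (s : R) :
  is_derive s (1 : R) fluidity (- (beta / p0) * fluidity s).
Proof.
(* With an affine exponent, the derivative is found by inference of [is_derive] instances. *)
rewrite (_ : fluidity = expR \o (fun t => beta - (beta / p0) * t)); last first.
  by apply/funext => t; rewrite /fluidity/=; congr expR; ring.
apply: is_derive_eq.
by rewrite /= /GRing.scale/=; ring.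
Qed.

Lemma differentiable_fluidity p x : differentiable p x ->
  differentiable (fluidity \o p) x.
Proof.
move=> dp; apply: differentiable_comp => //.
by apply/derivable1_diffP; have [] := is_derive_fluidity (p x).
Qed.

Lemma grad_fluidity p x : differentiable p x ->
  grad (fluidity \o p) x = - (beta / p0 * fluidity (p x)) *: grad p x.
Proof.
move=> dp; apply/colP => i; rewrite !mxE.
have [dg eg] := is_derive_fluidity (p x).
by rewrite derive_comp// eg mulNr.
Qed.

End barus.

Section reciprocity.
Context (R : realType) (n : nat) (Om Gp Gv : set 'cV[R]_n).
Context (nrm : 'cV[R]_n -> 'cV[R]_n) (K : 'cV[R]_n -> 'M[R]_n).
Context (mu0 p0 beta : R) (xi : 'cV[R]_n -> R).

Let solution := modified_barus_solution Om Gp Gv nrm K mu0 p0 beta xi.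

Lemma div_fluidity (pp1 vn1 pp2 vn2 p1 p2 : 'cV[R]_n -> R)
    (v1 v2 : 'cV[R]_n -> 'cV[R]_n) x :
  solution pp1 vn1 p1 v1 -> solution pp2 vn2 p2 v2 -> Om x ->
  div (fun y => fluidity p0 beta (p2 y) *: v1 y) x =
  beta / p0 * mu_tilde mu0 p0 beta xi x * dot (invmx (K x) *m v2 x) (v1 x).
Proof.
move=> s1 s2 Omx.
rewrite (@divZ _ _ (fluidity p0 beta \o p2)); first last.
- exact: sol_diff_v s1 _ Omx.
- by apply: differentiable_fluidity; exact: sol_diff_p s2 _ Omx.
rewrite (sol_mass s1 Omx) mulr0 add0r grad_fluidity; last first.
  exact: sol_diff_p s2 _ Omx.
(* The momentum equation replaces [grad p2] by minus the drag term; this sign cancels the one from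
   [grad_fluidity]. *)
have /addr0_eq <- := sol_momentum s2 Omx.
rewrite dotZl dotNl dotZl.
transitivity (beta / p0 * mu_tilde mu0 p0 beta xi x
   * dot (invmx (K x) *m v2 x) (v1 x)
   * (fluidity p0 beta (p2 x) * barus p0 beta (p2 x))); first by ring.
by rewrite fluidityM_barus mulr1.
Qed.

Lemma div_fluidity_sym (pp1 vn1 pp2 vn2 p1 p2 : 'cV[R]_n -> R)
    (v1 v2 : 'cV[R]_n -> 'cV[R]_n) x :
  solution pp1 vn1 p1 v1 -> solution pp2 vn2 p2 v2 ->
  Om x -> (K x)^T = K x ->
  div (fun y => fluidity p0 beta (p2 y) *: v1 y) x =
  div (fun y => fluidity p0 beta (p1 y) *: v2 y) x.
Proof.
move=> s1 s2 Omx KT; rewrite (div_fluidity s1 s2)// (div_fluidity s2 s1)//.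
(* Symmetry passes from [K x] to [invmx (K x)], which then moves across the dot product. *)
by rewrite dot_mulmx_sym// trmx_inv KT.
Qed.

(** Each part of the boundary uses data of a different solution: on [Gp] the weight is known from
    the second pressure condition, on [Gv] the normal velocity from the first velocity condition. *)
Lemma flux_fluidity (pp1 vn1 pp2 vn2 p1 p2 : 'cV[R]_n -> R)
    (v1 v2 : 'cV[R]_n -> 'cV[R]_n) :
  Gp `|` Gv = boundary Om -> Gp `&` Gv = set0 ->
  (@hausdorff_outer_measure R n n.-1).-cara.-measurable Gp ->
  (@hausdorff_outer_measure R n n.-1).-cara.-measurable Gv ->
  solution pp1 vn1 p1 v1 -> solution pp2 vn2 p2 v2 ->
  (surface_measure R n).-integrable (boundary Om)
    (fun x => (dot (fluidity p0 beta (p2 x) *: v1 x) (nrm x))%:E) ->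
  (surface_measure R n).-integrable Gv
    (fun x => (vn1 x * fluidity p0 beta (p2 x))%:E) ->
  (surface_measure R n).-integrable Gp
    (fun x => (fluidity p0 beta (pp2 x) * dot (v1 x) (nrm x))%:E) ->
  \int[surface_measure R n]_(x in boundary Om)
      dot (fluidity p0 beta (p2 x) *: v1 x) (nrm x) =
  \int[surface_measure R n]_(x in Gp)
      (fluidity p0 beta (pp2 x) * dot (v1 x) (nrm x)) +
  \int[surface_measure R n]_(x in Gv) (vn1 x * fluidity p0 beta (p2 x)).
Proof.
move=> GU GI mGp mGv s1 s2 iB iGv iGp; rewrite -GU in iB *.
rewrite Rintegral_setU//; last by apply/eqP.
have mU := measurableU _ _ mGp mGv.
have iBp := integrableS mU mGp (@subsetUl _ Gp Gv) iB.
have iBv := integrableS mU mGv (@subsetUr _ Gp Gv) iB.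
(* Placed in the context so that [filterS] finds the almost-everywhere filter. *)
have aeF := ae_filter_ringOfSetsType (surface_measure R n).
congr (_ + _).
- apply: ae_eq_Rintegral => //.
  apply: filterS (sol_pressure_bc s2) => x px Gx.
  by rewrite dotZl px.
- apply: ae_eq_Rintegral => //.
  apply: filterS (sol_velocity_bc s1) => x vx Gx.
  by rewrite dotZl vx// mulrC.
Qed.

End reciprocity.

Theorem theorem9 (R : realType) (nd : nat) (nd_gt0 : (0 < nd)%N)
  (Om Gp Gv : set 'cV[R]_nd) (nrm : 'cV[R]_nd -> 'cV[R]_nd)
  (K : 'cV[R]_nd -> 'M[R]_nd) (mu0 p0 beta : R)
  (rhob : 'cV[R]_nd -> 'cV[R]_nd) (xi : 'cV[R]_nd -> R)
  (pp1 vn1 pp2 vn2 p1 p2 : 'cV[R]_nd -> R)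
  (v1 v2 : 'cV[R]_nd -> 'cV[R]_nd) :
  bounded_lipschitz_domain Om ->
  normal_field Om nrm ->
  Gp `|` Gv = boundary Om ->
  Gp `&` Gv = set0 ->
  (@hausdorff_outer_measure R nd nd.-1).-cara.-measurable Gp ->
  (@hausdorff_outer_measure R nd nd.-1).-cara.-measurable Gv ->
  permeability Om K ->
  0 < mu0 -> 0 < p0 -> 0 <= beta ->
  (forall x, Om x -> differentiable xi x) ->
  (forall x, Om x -> rhob x = - grad xi x) ->
  modified_barus_solution Om Gp Gv nrm K mu0 p0 beta xi pp1 vn1 p1 v1 ->
  modified_barus_solution Om Gp Gv nrm K mu0 p0 beta xi pp2 vn2 p2 v2 ->
  divergence_theorem_applicable Om nrm
    (fun x => expR (- (beta * (p2 x / p0 - 1))) *: v1 x) ->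
  divergence_theorem_applicable Om nrm
    (fun x => expR (- (beta * (p1 x / p0 - 1))) *: v2 x) ->
  (surface_measure R nd).-integrable Gv
    (fun x => (vn2 x * expR (- (beta * (p1 x / p0 - 1))))%:E) ->
  (surface_measure R nd).-integrable Gp
    (fun x => (expR (- (beta * (pp2 x / p0 - 1))) * dot (v1 x) (nrm x))%:E) ->
  (surface_measure R nd).-integrable Gv
    (fun x => (vn1 x * expR (- (beta * (p2 x / p0 - 1))))%:E) ->
  (surface_measure R nd).-integrable Gp
    (fun x => (expR (- (beta * (pp1 x / p0 - 1))) * dot (v2 x) (nrm x))%:E) ->
  \int[surface_measure R nd]_(x in Gv)
      (vn2 x * expR (- (beta * (p1 x / p0 - 1))))
  - \int[surface_measure R nd]_(x in Gp)
      (expR (- (beta * (pp2 x / p0 - 1))) * dot (v1 x) (nrm x))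
  = \int[surface_measure R nd]_(x in Gv)
      (vn1 x * expR (- (beta * (p2 x / p0 - 1))))
  - \int[surface_measure R nd]_(x in Gp)
      (expR (- (beta * (pp1 x / p0 - 1))) * dot (v2 x) (nrm x)).
Proof.
move=> _ _ GU GI mGp mGv [KT _] _ _ _ _ _ s1 s2 [_ iB1 D1] [_ iB2 D2].
move=> iv2 ip2 iv1 ip1.
have divE : \int[volume_measure R nd]_(x in Om)
      div (fun x => fluidity p0 beta (p2 x) *: v1 x) x =
    \int[volume_measure R nd]_(x in Om)
      div (fun x => fluidity p0 beta (p1 x) *: v2 x) x.
  apply: eq_Rintegral => x; rewrite inE => Omx.
  exact: div_fluidity_sym s1 s2 Omx (KT _ Omx).
(* The divergence theorem turns the equal volume integrals into equal total boundary fluxes. *)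
move: divE; rewrite [LHS]D1 [RHS]D2.
rewrite (flux_fluidity GU GI mGp mGv s1 s2 iB1 iv1 ip2).
rewrite (flux_fluidity GU GI mGp mGv s2 s1 iB2 iv2 ip1) => fluxE.
(* Moving both [Gp] integrals across leaves the total weighted flux of [v1] on one side and that of
   [v2] on the other. *)
apply/eqP; rewrite subr_eq addrAC eq_sym subr_eq.
by rewrite [eqbRHS]addrC [eqbLHS]addrC fluxE.
Qed.
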